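(* Let $N$ be a positive integer and let $C_0,C_1,C_2$ be three uniform positive constants. Let $\mathcal{F}(t)$ be a polynomial of degree not more than $N$, considered on $S:=\{t\in\mathbb{R}: C_0^{-1}\le|t|\le C_0\}$, which satisfies $C_1^{-1}\le|\mathcal{F}'(t)|\le C_1$ and $|\mathcal{F}''(t)|\le C_2$ in $S$. Denote the inverse function of $\mathcal{F}$ by $F$. Let $\mathfrak{S}=\{s_i\}_{i=1}^{2^N}\subset[-\mathfrak{C}_0,\mathfrak{C}_0]$, with a certain uniform constant $\mathfrak{C}_0>0$, and $\mathfrak{A}=\{\alpha_j\}_{j=1}^N\subset\mathbb{R}$ be two strictly increasing sets, where the points of $\mathfrak{S}$ lie in the domain $\mathcal{F}(S)$ of $F$. Set $d(\mathfrak{S})=\min_{1\le i<j\le 2^N}|s_j-s_i|$, and set $D_j(\mathfrak{A})=\prod_{1\le i\le N,\ i\neq j}|\alpha_j-\alpha_i|$ if $N\ge2$ and $D_j(\mathfrak{A})=1$ if $N=1$. Suppose there are a constant $A_0>0$ and $\{a_j\}_{j=1}^N\subset\mathbb{R}$ such that $$\Big|\sum_{j=1}^N a_jF(s)^{\alpha_j}\Big|\le A_0\qquad\text{for any } s\in\mathfrak{S}.$$ Then there exists a positive constant $\tilde C$ depending only on $\{\alpha_i\}_{i=1}^N$, $C_1$ and $C_0$ such that $$|a_j|\le\frac{\tilde C^{\,N\big((\alpha_N-\alpha_1)+\min_{1\le i\le N}|\alpha_i|+2\big)}A_0}{\big(d(\mathfrak{S})\big)^{N-1}D_j(\mathfrak{A})}$$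 holds for $1\le j\le N$. In particular, $\tilde C=2C_1C_0^{\max_{1\le i\le N}|\alpha_i|+1}$ is enough.
   Context: The inverse function $F$ of $\mathcal{F}$ takes values in $S$ and satisfies $C_0^{-1}\le|F|\le C_0$, $F'(\tau)=\frac{1}{\mathcal{F}'(F(\tau))}$ and $|F'|\ge C_1^{-1}$. *)

(* Defs.v *)
From HB Require Import structures.
From mathcomp Require Import all_boot all_order all_algebra.
From mathcomp Require Import all_classical all_reals all_analysis.
From mathcomp Require Import complex.

Set Implicit Arguments.
Unset Strict Implicit.
Unset Printing Implicit Defensive.

Import Order.TTheory GRing.Theory Num.Theory.
Local Open Scope classical_set_scope.
Local Open Scope ring_scope.
Local Open Scope complex_scope.

Definition annulus (R : realType) (C0 : R) : set R :=
  [set t | C0^-1 <= `|t| <= C0].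

(* t ^ a = exp (a * log t) for real t != 0 and real a, where log is the real
   logarithm for t > 0 and log t = ln |t| + (2k + 1) * pi * i for t < 0.  The
   branch index k is left free: k = 0 is the principal value, and whenever
   finitely many exponents are rationals p / q in lowest terms with q odd
   (e.g. integers), taking 2k + 1 to be a common multiple of the q's gives the
   usual real values (-1) ^ p * |t| ^ (p / q).
   The library's [powR] is not usable here: it is constantly 1 for t < 0. *)
Definition cpowr (R : realType) (k : int) (t a : R) : R[i] :=
  let arg := if 0 < t then 0 else (2 * k + 1)%:~R * pi in
  (`|t| `^ a)%:C * (cos (a * arg) +i* sin (a * arg)).

(* For n >= 2 the initial value of the iterated minimum is itself one of the
   distances involved. *)
Definition min_dist (R : realType) (n : nat) (s : n.-tuple R) : R :=
  \big[Num.min/`|s`_1 - s`_0|]_(p : 'I_n * 'I_n | (p.1 < p.2)%N)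
     `|s`_p.2 - s`_p.1|.

Definition prod_dist (R : realType) (n : nat) (alpha : n.-tuple R) (j : 'I_n)
    : R :=
  \prod_(i < n | i != j) `|alpha`_j - alpha`_i|.

(* As above, for n >= 1 the initial values |alpha_0| are among the terms. *)
Definition min_abs (R : realType) (n : nat) (alpha : n.-tuple R) : R :=
  \big[Num.min/`|alpha`_0|]_(i < n) `|alpha`_i|.

Definition max_abs (R : realType) (n : nat) (alpha : n.-tuple R) : R :=
  \big[Num.max/`|alpha`_0|]_(i < n) `|alpha`_i|.

(* "The constant Ct is enough": everything Ct may not depend on is quantified
   here.  The hypothesis that F is a left inverse of p on the annulus says both
   that p is injective there and that F is its inverse on the image. *)
Definition coef_bound_holds (R : realType) (N : nat) (C0 C1 : R)
    (alpha : N.-tuple R) (Ct : R) : Prop :=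
  forall (C2 : R) (p : {poly R}) (F : R -> R) (cS : R) (s : (2 ^ N).-tuple R)
         (k : int) (A0 : R) (a : N.-tuple R),
  0 < C2 ->
  (size p <= N.+1)%N ->
  (forall t, annulus C0 t -> C1^-1 <= `|p^`().[t]| <= C1) ->
  (forall t, annulus C0 t -> `|p^`(2).[t]| <= C2) ->
  (forall t, annulus C0 t -> F p.[t] = t) ->
  0 < cS ->
  sorted <%R s ->
  (forall i : 'I_(2 ^ N), - cS <= s`_i <= cS) ->
  (forall i : 'I_(2 ^ N), (horner p @` annulus C0) s`_i) ->
  0 < A0 ->
  (forall i : 'I_(2 ^ N),
     `| \sum_(j < N) (a`_j)%:C * cpowr k (F s`_i) alpha`_j | <= A0%:C) ->
  forall j : 'I_N,
  `|a`_j| <=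
    Ct `^ (N%:R * (alpha`_N.-1 - alpha`_0 + min_abs alpha + 2)) * A0
      / (min_dist s ^+ N.-1 * prod_dist alpha j).

(* Main.v *)
Require Import Defs.
From mathcomp Require Import all_boot all_order all_algebra.
From mathcomp Require Import all_classical all_reals all_analysis.
From mathcomp Require Import complex polyrcf zify ring lra.
Import Order.TTheory GRing.Theory Num.Theory.
Local Open Scope ring_scope.

(** The estimate is a quantitative form of the fact that a generalized
    polynomial with N exponents has at most N - 1 positive zeros, and its proof
    is a quantitative Rolle argument.

    Half of the 2 ^ N points t = F s have the same sign.  On them the complex
    powers t ^ alpha_l have the fixed phases alpha_l * theta, so multiplying the
    sum by a unit complex number that makes the j-th phase trivial and taking
    real parts gives a real sum, still bounded by A0, whose j-th coefficient is
    a_j itself ([rotated_expsum_le]).  In the variable x = ln |t| it is an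
    exponential sum, small at 2 ^ (N - 1) points.  Since the derivative of the
    polynomial is at most C1 and x ranges between - ln C0 and ln C0, these points
    inherit the separation d / (C1 * C0) from the s ([annulus_lipschitz],
    [ln_gap]).

    To remove the term with exponent b, multiply by exp (- b * x) and
    differentiate.  The mean value theorem on pairs of consecutive points gives
    half as many points, equally well separated, at which the resulting sum with
    one term less is bounded ([expsum_rolle]).  After N - 1 rounds one point and
    the j-th term remain, its coefficient multiplied by the differences
    alpha_j - alpha_l ([expsum_coef_bound]).  Bookkeeping of the constants shows
    that 2 * C1 * C0 ^ (max |alpha| + 1) to the power 2 N is enough
    ([elimination_constant_le]), which is at most the stated power because that
    number is at least 1. *)

(** * Exponential sums on separated points *)

(** An entry (c, e) of the list stands for the term c * exp (e * x): the
    generalized polynomial c * t ^ e after the substitution t = exp x. *)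
Definition expsum {R : realType} (l : seq (R * R)) (x : R) : R :=
  \sum_(u <- l) u.1 * expR (u.2 * x).

(** The terms of the derivative of exp (- b * x) times the exponential sum;
    this operation preserves the differences of exponents. *)
Definition shift_derive {R : realType} (b : R) (l : seq (R * R)) :=
  [seq (u.1 * (u.2 - b), u.2 - b) | u <- l].

Lemma is_derive_expsum {R : realType} (l : seq (R * R)) (b x : R) :
  is_derive x 1 (fun y => expR (- b * y) * expsum l y)
    (expsum (shift_derive b l) x).
Proof.
have -> : (fun y => expR (- b * y) * expsum l y) =
          (fun y => \sum_(u <- l) u.1 * expR ((u.2 - b) * y)).
  apply/funext => y; rewrite /expsum mulr_sumr; apply: eq_bigr => u _.
  by rewrite mulrCA -expRD; congr (_ * expR _); ring.
rewrite /expsum big_map /=.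
elim: l => [|[c e] l IH] /=.
  rewrite big_nil.
  have -> : (fun y : R => \sum_(u <- [::]) u.1 * expR ((u.2 - b) * y)) = cst 0.
    by apply/funext => y; rewrite big_nil.
  exact: is_derive_cst.
rewrite big_cons.
have -> : (fun y : R => \sum_(u <- (c, e) :: l) u.1 * expR ((u.2 - b) * y)) =
    (fun y => c * expR ((e - b) * y)) +
    (fun y => \sum_(u <- l) u.1 * expR ((u.2 - b) * y)).
  by apply/funext => y; rewrite big_cons.
apply: is_deriveD.
have d1 : is_derive x 1 (fun y : R => (e - b) * y) (e - b).
  have := is_deriveZ (e - b) (is_derive_id x (1 : R)).
  by rewrite /GRing.scale /= mulr1.
have d2 := is_derive1_comp (is_derive_expR ((e - b) * x)) d1.
have := is_deriveZ c d2; rewrite /GRing.scale /= => d3.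
rewrite [X in is_derive _ _ _ X](_ : _ = c * (expR ((e - b) * x) * (e - b))) //=.
ring.
Qed.

(** The elimination step, a mean-value form of Rolle's argument: smallness of
    the sum at two points h apart passes to the shifted derivative at a point
    between them.  That point lies in the closed interval spanned by the two,
    so disjoint pairs produce points that inherit the separation of the pairs. *)
Lemma expsum_rolle {R : realType} (l : seq (R * R)) (b x y h A E : R) :
  0 < h -> x + h <= y -> expR (- b * x) <= E -> expR (- b * y) <= E ->
  `|expsum l x| <= A -> `|expsum l y| <= A ->
  exists2 z, x <= z <= y & `|expsum (shift_derive b l) z| <= A * (2 / h * E).
Proof.
move=> h0 xhy Ex Ey fx fy.
have xy : x < y by apply: lt_le_trans xhy; rewrite ltrDl.
pose g (z : R) : R := expR (- b * z) * expsum l z.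
have dg (z : R) : is_derive z (1 : R) g (expsum (shift_derive b l) z)
  by exact: is_derive_expsum.
have [|z zxy gE] := @MVT _ g _ x y xy (fun z _ => dg z).
  apply: derivable_within_continuous => z _.
  by case: (dg z).
exists z; first by move: zxy; rewrite in_itv /= => /andP[/ltW -> /ltW ->].
have gA w : expR (- b * w) <= E -> `|expsum l w| <= A -> `|g w| <= E * A.
  by move=> hE hA; rewrite /g normrM ger0_norm ?expR_ge0// ler_pM ?expR_ge0.
have yx0 : 0 < y - x by rewrite subr_gt0.
have hEA : 0 <= E * A.
  by rewrite mulr_ge0 ?(le_trans _ Ex) ?expR_ge0 ?(le_trans _ fx).
have -> : A * (2 / h * E) = (E * A + E * A) / h by ring.
rewrite ler_pdivlMr//; apply: (@le_trans _ _ `|g y - g x|).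
  by rewrite gE normrM ler_wpM2l// ger0_norm; [lra|exact: ltW].
by apply: (le_trans (ler_normB _ _)); apply: lerD; exact: gA.
Qed.

(** All exponents but that of u are eliminated, each at the cost of halving the
    number of points, because consecutive points are paired: the gap between
    two of the new points contains a gap between two old ones, so the
    separation h survives every round.  Eliminating v multiplies the
    coefficient of u by the difference u.2 - v.2, whence the product.
    Exponents are differences of the original ones after the first round, which
    is why a single bound B on exponents and on their differences controls
    every exponential factor. *)
Lemma expsum_coef_bound {R : realType} (B L h : R) :
  0 <= L -> 0 < h ->
  forall (bs : seq (R * R)) (u : R * R) (x : nat -> R) (A : R),
  (forall v, v \in u :: bs -> `|v.2| <= B) ->
  (forall v w, v \in u :: bs -> w \in u :: bs -> `|v.2 - w.2| <= B) ->
  (forall i, (i < 2 ^ size bs)%N -> `|x i| <= L) ->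
  (forall i, (i.+1 < 2 ^ size bs)%N -> x i + h <= x i.+1) ->
  (forall i, (i < 2 ^ size bs)%N -> `|expsum (u :: bs) (x i)| <= A) ->
  `|u.1| * \prod_(v <- bs) `|u.2 - v.2|
    <= A * expR (B * L) * (2 / h * expR (B * L)) ^+ size bs.
Proof.
move=> L0 h0.
have expB b y : `|b| <= B -> `|y| <= L -> expR (- b * y) <= expR (B * L).
  move=> hb hy; rewrite ler_expR; apply: (le_trans (ler_norm _)).
  by rewrite normrM normrN ler_pM.
move=> bs; have [n] := ubnP (size bs).
(* The induction is on the length, as the remaining terms are modified too. *)
elim: n bs => // n IHn [|v bs] hn u x A hB hD hL hx hA.
  have /= := hA 0 isT; rewrite /expsum big_seq1 => hA0.
  rewrite big_nil mulr1 expr0 mulr1.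
  have -> : `|u.1| = `|u.1 * expR (u.2 * x 0)| * expR (- u.2 * x 0).
    rewrite normrM (ger0_norm (expR_ge0 _)) -mulrA -expRD.
    by rewrite -mulrDl subrr mul0r expR0 mulr1.
  apply: ler_pM; rewrite ?normr_ge0 ?expR_ge0 ?hA0 //.
  by apply: expB; [apply: hB; rewrite mem_head | exact: (hL 0)].
pose m := (2 ^ size bs)%N.
have mE : (2 ^ size (v :: bs) = m.*2)%N by rewrite /= expnS mul2n.
rewrite mE in hL hx hA.
have vB : `|v.2| <= B by apply: hB; rewrite !inE eqxx orbT.
pose bs' := shift_derive v.2 bs.
pose u' := (u.1 * (u.2 - v.2), u.2 - v.2).
pose A' := A * (2 / h * expR (B * L)).
have sz' : size bs' = size bs by rewrite size_map.
(* The term v itself has become a constant, which the derivative kills. *)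
have drop z :
    expsum (shift_derive v.2 (u :: v :: bs)) z = expsum (u' :: bs') z.
  by rewrite /expsum /= !big_cons /= subrr mulr0 mul0r add0r.
have /choice[y hy] : forall i, exists y, (i < m)%N ->
   x i.*2 <= y <= x i.*2.+1 /\ `|expsum (u' :: bs') y| <= A'.
  move=> i; case: (ltnP i m) => [im|_]; last by exists 0.
  have i1 : (i.*2.+1 < m.*2)%N by rewrite ltn_Sdouble.
  have i0 : (i.*2 < m.*2)%N by rewrite ltn_double.
  have [||||z hz hzA] := @expsum_rolle _ (u :: v :: bs) v.2
    (x i.*2) (x i.*2.+1) h A (expR (B * L)) h0 (hx _ i1).
  - by apply: expB => //; exact: hL.
  - by apply: expB => //; exact: hL.
  - exact: hA.
  - exact: hA.
  by exists z => _; split => //; rewrite -drop.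
have lift w : w \in u' :: bs' ->
    exists2 w0, w0 \in u :: v :: bs & w.2 = w0.2 - v.2.
  rewrite inE => /orP[/eqP->|]; first by exists u => //; rewrite mem_head.
  by move=> /mapP[w0 hw0 ->]; exists w0 => //; rewrite !inE hw0 !orbT.
have vin : v \in u :: v :: bs by rewrite !inE eqxx orbT.
have := IHn bs' _ u' y A'.
rewrite sz' => /(_ hn).
rewrite big_cons mulrA -(normrM u.1).
have -> : \prod_(w <- bs') `|u'.2 - w.2| = \prod_(w <- bs) `|u.2 - w.2|.
  rewrite big_map; apply: eq_bigr => w _ /=; congr `|_|; ring.
rewrite /= (exprS _ (size bs)) => IHb.
rewrite -[`|u.1 * (u.2 - v.2)|]/(`|u'.1|).
apply: (le_trans (IHb _ _ _ _ _)).
- by move=> w /lift[w0 hw0 ->]; exact: hD.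
- move=> w1 w2 /lift[v1 h1 ->] /lift[v2 h2 ->].
  by rewrite opprB addrA subrK; exact: hD.
- move=> i im; have [/andP[y0 y1] _] := hy i im.
  have /ler_normlP[h1 h2] : `|x i.*2| <= L by apply: hL; rewrite ltn_double.
  have /ler_normlP[h3 h4] : `|x i.*2.+1| <= L by apply: hL; rewrite ltn_Sdouble.
  by rewrite ler_norml; apply/andP; split; lra.
- move=> i im; have [/andP[_ y1] _] := hy i (ltnW im).
  have [/andP[y2 _] _] := hy i.+1 im.
  apply: le_trans y2; rewrite doubleS.
  apply: le_trans (hx _ _); first by rewrite lerD2r.
  by rewrite -doubleS ltn_double.
- by move=> i im; have [_] := hy i im.
rewrite /A' le_eqVlt; apply/orP; left; apply/eqP; rewrite -/m; ring.
Qed.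

(** * Geometry of the nodes *)

(** From ln (x / y) <= x / y - 1, the smaller node being x. *)
Lemma ln_gap {R : realType} (C x y : R) : 0 < x <= C -> 0 < y <= C ->
  `|x - y| <= C * `|ln x - ln y|.
Proof.
wlog xy : x y / x <= y.
  move=> W hx hy; case/orP: (le_total x y) => [xy|yx]; first exact: W.
  by rewrite distrC (distrC (ln x)); apply: W.
move=> /andP[x0 xC] /andP[y0 yC].
have xy0 : 0 < x / y by rewrite divr_gt0.
have := @le_ln1Dx R (x / y - 1) _; rewrite (addrC 1) subrK ltrBrDr addNr.
move=> /(_ xy0); rewrite ln_div ?posrE// => h.
have lxy : ln x <= ln y by rewrite ler_ln ?posrE.
rewrite distrC ger0_norm ?subr_ge0// distrC ger0_norm ?subr_ge0//.
have -> : y - x = y * (1 - x / y) by field; exact: lt0r_neq0.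
apply: ler_pM => //; first exact: ltW.
- by rewrite subr_ge0 ler_pdivrMr// mul1r.
- lra.
Qed.

(** Nodes of equal sign are joined by a segment inside the annulus, so that the
    derivative bound applies along it; this fails across the origin. *)
Lemma annulus_lipschitz {R : realType} (C0 C1 : R) (p : {poly R}) (t t' : R) :
  0 < C0 ->
  (forall t, annulus C0 t -> `|p^`().[t]| <= C1) ->
  annulus C0 t -> annulus C0 t' -> (0 < t) = (0 < t') ->
  `|p.[t] - p.[t']| <= C1 * `|t - t'|.
Proof.
move=> C00 hp.
wlog tt : t t' / t < t'.
  move=> W ht ht' s; have [tt|tt|->] := ltgtP t t'; first exact: W.
    by rewrite distrC (distrC t); apply: W.
  by rewrite !subrr !normr0 mulr0.
move=> ht ht' s; rewrite distrC (distrC t).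
have [c /[!in_itv]/= /andP[tc ct] ->] := poly_mvt p tt.
rewrite normrM; apply: ler_wpM2r => //; apply: hp.
have Ci : 0 < C0^-1 by rewrite invr_gt0.
move: ht ht'; rewrite /annulus /= => /andP[t1 t2] /andP[t3 t4].
have [t0|t0] := ltP 0 t'.
  have tp : 0 < t by rewrite s.
  have cp : 0 < c by exact: lt_trans tp tc.
  move: t1 t2 t3 t4; rewrite !gtr0_norm // => t1 t2 t3 t4.
  by apply/andP; split; lra.
have cn : c <= 0 by lra.
have tn : t <= 0 by lra.
move: t1 t2 t3 t4; rewrite !ler0_norm // => t1 t2 t3 t4.
by apply/andP; split; lra.
Qed.

Lemma sort_gap {R : realType} (h : R) (xs : seq R) : uniq xs ->
  (forall x y, x \in xs -> y \in xs -> x != y -> h <= `|x - y|) ->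
  forall i, (i.+1 < size xs)%N ->
    (sort <=%O xs)`_i + h <= (sort <=%O xs)`_i.+1.
Proof.
move=> U hx i hi; set ys := sort _ _.
have sz : size ys = size xs by rewrite size_sort.
have i1 : (i.+1 < size ys)%N by rewrite sz.
have i0 : (i < size ys)%N by apply: ltnW.
have lt : ys`_i < ys`_i.+1.
  by rewrite lt_sorted_ltn_nth ?inE// sort_lt_sorted.
have m k : (k < size ys)%N -> ys`_k \in xs.
  by move=> hk; rewrite -(mem_sort <=%O) mem_nth.
have := hx _ _ (m _ i1) (m _ i0); rewrite gt_eqF// => /(_ isT).
by rewrite gtr0_norm ?subr_gt0// lerBrDl.
Qed.

Lemma min_dist_le {R : realType} (n : nat) (s : n.-tuple R) (x y : R) :
  x \in s -> y \in s -> x != y -> min_dist s <= `|x - y|.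
Proof.
move=> /tnthP[i ->] /tnthP[j ->] ne.
have W (i' j' : 'I_n) : (i' < j')%N -> min_dist s <= `|tnth s j' - tnth s i'|.
  by move=> h; rewrite !(tnth_nth 0); apply: (@bigmin_le_cond _ _ _ _ (i', j')).
have [h|h|e] := ltngtP i j; [by rewrite distrC; apply: W|by apply: W|].
by move: ne; rewrite (val_inj e) eqxx.
Qed.

Lemma min_dist_gt0 {R : realType} (n : nat) (s : n.-tuple R) :
  (1 < n)%N -> sorted <%R s -> 0 < min_dist s.
Proof.
move=> n1 hs.
have lt i j : (i < j < n)%N -> 0 < `|s`_j - s`_i|.
  move=> /andP[ij jn]; rewrite normr_gt0 subr_eq0 gt_eqF//.
  by rewrite lt_sorted_ltn_nth ?inE ?size_tuple// (ltn_trans ij).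
apply: lt_bigmin; first by apply: lt; rewrite n1.
by move=> [i j] /= ij; apply: lt; rewrite ij ltn_ord.
Qed.

(** * Removing the phases *)

(** The argument given by [cpowr] to a nonzero number of sign b. *)
Definition branch_arg {R : realType} (k : int) (b : bool) : R :=
  if b then 0 else (2 * k + 1)%:~R * pi.

(** The real part of exp (- i * phi) times the complex sum.  Passing to real
    parts makes the mean value theorem available, and for phi equal to the phase
    of the j-th term the cosine is 1 there, so that its coefficient is kept. *)
Lemma rotated_expsum_le {R : realType} (N : nat) (k : int) (a al : 'I_N -> R)
    (t A phi : R) :
  t != 0 ->
  `|\sum_(l < N) ((a l)%:C)%C * cpowr k t (al l)| <= (A%:C)%C ->
  `|\sum_(l < N) a l * cos (al l * branch_arg k (0 < t) - phi)
       * expR (al l * ln `|t|)| <= A.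
Proof.
move=> t0; set th := branch_arg k _.
pose X := \sum_(l < N) a l * expR (al l * ln `|t|) * cos (al l * th).
pose Y := \sum_(l < N) a l * expR (al l * ln `|t|) * sin (al l * th).
have -> : \sum_(l < N) ((a l)%:C)%C * cpowr k t (al l) = (X +i* Y)%C.
  rewrite /X /Y; elim/big_ind3: _ => //.
    by move=> x1 x2 x3 y1 y2 y3 -> ->.
  move=> l _; rewrite /cpowr -/(branch_arg k (0 < t)) -/th.
  rewrite /powR normr_eq0 (negbTE t0).
  by congr (_ +i* _)%C => /=; ring.
rewrite normc_def lecR /= => hA.
have -> : \sum_(l < N) a l * cos (al l * th - phi) * expR (al l * ln `|t|)
   = X * cos phi + Y * sin phi.
  rewrite /X /Y !mulr_suml -big_split /=; apply: eq_bigr => l _.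
  rewrite cosB; ring.
apply: le_trans hA; rewrite -sqrtr_sqr ler_sqrt; last
  by rewrite addr_ge0 ?sqr_ge0.
have e := cos2Dsin2 phi.
(* Cauchy-Schwarz against the unit vector (cos phi, sin phi). *)
have -> : X ^+ 2 + Y ^+ 2 = (X * cos phi + Y * sin phi) ^+ 2
    + (X * sin phi - Y * cos phi) ^+ 2.
  rewrite -[X ^+ 2 + _]mulr1 -e; ring.
by rewrite lerDl sqr_ge0.
Qed.

(** * The coefficient estimate *)

Lemma separated_coef_bound {R : realType} (n : nat) (c al : 'I_n.+1 -> R)
    (M L h A : R) (xs : seq R) (j : 'I_n.+1) :
  0 <= L -> 0 < h ->
  (forall l, `|al l| <= M) -> (2 ^ n <= size xs)%N -> uniq xs ->
  (forall x, x \in xs -> `|x| <= L) ->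
  (forall x y, x \in xs -> y \in xs -> x != y -> h <= `|x - y|) ->
  (forall x, x \in xs -> `|\sum_l c l * expR (al l * x)| <= A) ->
  `|c j| * \prod_(l | l != j) `|al j - al l|
    <= A * expR (2 * M * L) * (2 / h * expR (2 * M * L)) ^+ n.
Proof.
move=> L0 h0 hM sz U hL hh hA.
pose bs := [seq (c l, al l) | l <- enum (predC1 j)].
have szb : size bs = n by rewrite size_map -cardE cardC1 card_ord.
have -> : \prod_(l | l != j) `|al j - al l| = \prod_(v <- bs) `|al j - v.2|.
  by rewrite big_map big_enum.
have sE x : expsum ((c j, al j) :: bs) x = \sum_l c l * expR (al l * x).
  by rewrite /expsum big_cons big_map big_enum /= [RHS](bigD1 j).
have hM2 v : v \in (c j, al j) :: bs -> `|v.2| <= M.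
  rewrite inE => /orP[/eqP->|/mapP[l _ ->]]; exact: hM.
have M0 : 0 <= M by apply: le_trans (hM j).
pose ys := sort <=%O xs.
have inx i : (i < 2 ^ n)%N -> ys`_i \in xs.
  by move=> hi; rewrite -(mem_sort <=%O) mem_nth// size_sort (leq_trans hi).
have := @expsum_coef_bound _ (2 * M) L h L0 h0 bs (c j, al j) (nth 0 ys) A.
rewrite szb; apply.
- by move=> v /hM2 hv; lra.
- move=> v w /hM2 hv /hM2 hw; apply: (le_trans (ler_normB _ _)); lra.
- by move=> i /inx; exact: hL.
- by move=> i hi; apply: sort_gap => //; exact: leq_trans sz.
- by move=> i /inx hi; rewrite sE; exact: hA.
Qed.

(** The reason for 2 ^ N nodes rather than 2 ^ (N - 1): only nodes on one side
    of the origin can be compared. *)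
Lemma same_sign_half {R : realType} (n : nat) (T : seq R) :
  (2 ^ n.+1 <= size T)%N ->
  exists b, (2 ^ n <= size [seq t <- T | (0 < t)%R == b])%N.
Proof.
move=> h; have := count_predC (fun t : R => 0 < t) T.
have [h1|h1] := leqP (2 ^ n) (count (fun t : R => 0 < t) T).
  exists true; rewrite size_filter.
  by rewrite (eq_count (a2 := fun t : R => 0 < t))// => t /=; rewrite eqb_id.
move=> e; exists false; rewrite size_filter.
rewrite (eq_count (a2 := predC (fun t : R => 0 < t))); last first.
  by move=> t /=; rewrite eqbF_neg.
by move: h; rewrite -e expnS; lia.
Qed.

(** With G = C0 ^ (2 * M), each elimination round costs 2 * C1 * C0 * G over d,
    and recovering the last coefficient costs one more G.  Each of these n + 1
    factors is at most the square of 2 * C1 * C0 ^ (M + 1), so any exponent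
    E >= 2 * (n + 1) is enough. *)
Lemma elimination_constant_le {R : realType} (n : nat) (C0 C1 M E A d : R) :
  1 <= C0 -> 1 <= C1 -> 0 <= M -> 2 * n.+1%:R <= E -> 0 <= A -> 0 < d ->
  let G := expR (2 * M * ln C0) in
  A * G * (2 / (d / (C1 * C0)) * G) ^+ n * d ^+ n
    <= (2 * C1 * C0 `^ (M + 1)) `^ E * A.
Proof.
move=> c0 c1 M0 hE A0 d0; set G := expR _ => /=.
set Ct := 2 * C1 * _.
have C00 : 0 < C0 by lra.
have g1 : 1 <= C0 `^ M by rewrite -(powRr0 C0) ler_powR.
have GE : G = (C0 `^ M) ^+ 2.
  by rewrite /G /powR gt_eqF// expr2 -expRD; congr expR; ring.
have CtE : Ct = 2 * C1 * C0 * C0 `^ M.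
  have C0n : C0 != 0 by rewrite gt_eqF.
  rewrite /Ct powRD; last by rewrite C0n implybT.
  rewrite powRr1; [ring|exact: ltW].
have G1 : 1 <= G by rewrite GE expr_ge1// (le_trans _ g1).
have a1 : 1 <= 2 * C1 * C0 by nra.
have hG : G <= Ct ^+ 2.
  by rewrite CtE exprMn -GE ler_peMl ?expr_ge1//; lra.
have hG2 : 2 * C1 * C0 * G <= Ct ^+ 2.
  rewrite CtE exprMn -GE ler_wpM2r//; first lra.
  by rewrite expr2 ler_peMl//; lra.
have Ct1 : 1 <= Ct by rewrite CtE; nra.
rewrite -mulrA -exprMn.
have -> : 2 / (d / (C1 * C0)) * G * d = 2 * C1 * C0 * G.
  by field; rewrite !gt_eqF//; lra.
rewrite -mulrA (mulrC _ A) ler_wpM2l//.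
apply: (@le_trans _ _ ((Ct ^+ 2) ^+ n.+1)).
  rewrite exprS; apply: ler_pM => //; [lra|by rewrite exprn_ge0//; nra|].
  by apply: lerXn2r => //; rewrite ?nnegrE; nra.
rewrite -exprM -powR_mulrn; last lra.
by apply: ler_powR => //; rewrite natrM.
Qed.

(** The nodes are x = ln |F s| for those s where F s has the more frequent
    sign; they lie in the interval from - ln C0 to ln C0 and are separated by
    the minimal distance of the s divided by C1 * C0. *)
Lemma coef_bound_explicit {R : realType} (N : nat) (C0 C1 : R)
    (alpha : N.-tuple R) :
  (0 < N)%N -> 0 < C0 -> 0 < C1 -> sorted <%R alpha ->
  coef_bound_holds C0 C1 alpha (2 * C1 * C0 `^ (max_abs alpha + 1)).
Proof.
case: N alpha => // n alpha _ C00 C10 hal.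
move=> C2 p F cS s k A a _ _ hp1 _ hF _ hs _ him A0 hA j.
have ord (x : R) : x \in s -> exists i : 'I_(2 ^ n.+1), x = s`_i.
  by move=> /tnthP[i ->]; exists i => //; rewrite (tnth_nth 0).
have Fs x : x \in s -> annulus C0 (F x) /\ p.[F x] = x.
  by move=> /ord[i ->]; have [t ht <-] := him i; rewrite hF.
have n2 : (1 < 2 ^ n.+1)%N by rewrite (ltn_exp2l 0).
have s0 : s`_0 \in s by rewrite mem_nth// size_tuple ltnW.
have [t0 _] := Fs _ s0.
(* The point F s_0 of the annulus forces C0^-1 <= C0, and the two bounds on the
   derivative there force C1^-1 <= C1. *)
have C0g1 : 1 <= C0.
  move: t0; rewrite /annulus /= => /andP[u1 u2].
  have := le_trans u1 u2; rewrite -[_ <= _](ler_pM2l C00) divff ?gt_eqF// => h.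
  by rewrite leNgt; apply/negP => h1; move: h; nra.
have C1g1 : 1 <= C1.
  have /andP[u1 u2] := hp1 _ t0.
  have := le_trans u1 u2; rewrite -[_ <= _](ler_pM2l C10) divff ?gt_eqF// => h.
  by rewrite leNgt; apply/negP => h1; move: h; nra.
pose d := min_dist s.
have d0 : 0 < d by exact: min_dist_gt0.
pose h := d / (C1 * C0).
have h0 : 0 < h by rewrite divr_gt0 ?mulr_gt0.
have Us : uniq s by apply: (sorted_uniq lt_trans ltxx).
have [b hb] :
    exists b, (2 ^ n <= size [seq t <- [seq F x | x <- s] | (0 < t)%R == b])%N.
  by apply: same_sign_half; rewrite size_map size_tuple.
set T := [seq t <- _ | _] in hb.
have UT : uniq T.
  rewrite filter_uniq// map_inj_in_uniq// => x y /Fs[_ {2}<-] /Fs[_ {2}<-] -> //.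
have TP t : t \in T ->
    [/\ (0 < t) = b, annulus C0 t & exists2 x, x \in s & t = F x].
  rewrite mem_filter => /andP[/eqP tb /mapP[x xs tE]]; split => //; last by exists x.
  by rewrite tE; have [] := Fs x xs.
have Tpos t : t \in T -> 0 < `|t| <= C0.
  move=> /TP[_ /andP[u1 ->] _]; rewrite andbT; apply: lt_le_trans u1.
  by rewrite invr_gt0.
have Tgap t t' : t \in T -> t' \in T -> t != t' -> h <= `|ln `|t| - ln `|t'| |.
  move=> tT tT' ne.
  have [tb ta [x xs tE]] := TP t tT; have [tb' ta' [x' xs' tE']] := TP t' tT'.
  have xx : x != x' by apply: contraNneq ne => xx; rewrite tE tE' xx.
  rewrite ler_pdivrMr ?mulr_gt0// mulrC.
  apply: le_trans (min_dist_le _ _ _ _ xs xs' xx) _.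
  have [_ <-] := Fs x xs; have [_ <-] := Fs x' xs'; rewrite -tE -tE'.
  apply: (le_trans (@annulus_lipschitz _ C0 C1 p t t' C00 _ ta ta' _)).
  - by move=> u /hp1/andP[].
  - by rewrite tb tb'.
  rewrite -mulrA ler_pM2l//.
  apply: le_trans (ln_gap _ _ _ (Tpos _ tT) (Tpos _ tT')).
  move: tb tb'; case: (b) => tb tb'; first
    by rewrite (gtr0_norm (x := t)) ?tb// (gtr0_norm (x := t')) ?tb'.
  have tn : t <= 0 by rewrite leNgt tb.
  have tn' : t' <= 0 by rewrite leNgt tb'.
  by rewrite (ler0_norm tn) (ler0_norm tn') -opprD normrN.
pose xs := [seq ln `|t| | t <- T].
pose al (l : 'I_n.+1) := alpha`_l.
pose th : R := branch_arg k b.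
pose c (l : 'I_n.+1) := a`_l * cos (al l * th - al j * th).
have hM l : `|al l| <= max_abs alpha by exact: le_bigmax.
have M0 : 0 <= max_abs alpha by apply: le_trans (hM j).
have L0 : 0 <= ln C0 by rewrite ln_ge0.
have Uxs : uniq xs.
  rewrite map_inj_in_uniq// => t t' tT tT' e; apply/eqP/negPn/negP => ne.
  by have := Tgap _ _ tT tT' ne; rewrite e subrr normr0 leNgt h0.
have key := @separated_coef_bound R n c al (max_abs alpha) (ln C0) h A xs j
  L0 h0 hM _ Uxs.
have {key} key : `|c j| * \prod_(l | l != j) `|al j - al l|
    <= A * expR (2 * max_abs alpha * ln C0)
         * (2 / h * expR (2 * max_abs alpha * ln C0)) ^+ n.
  apply: key.
  - by rewrite size_map.
  - move=> x /mapP[t tT ->].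
    have [_ /andP[u1 u2] _] := TP t tT; have /andP[u0 _] := Tpos t tT.
    rewrite ler_norml -lnV ?posrE// !ler_ln ?posrE ?invr_gt0//.
    by rewrite u1 u2.
  - move=> x y /mapP[t tT ->] /mapP[t' tT' ->] ne; apply: Tgap => //.
    by apply: contraNneq ne => ->.
  - move=> x /mapP[t tT ->]; have [tb _ [y ys tE]] := TP t tT.
    have tn0 : t != 0 by rewrite -normr_gt0; have /andP[] := Tpos t tT.
    have [i yE] := ord y ys.
    have := hA i; rewrite -yE -tE => hAt.
    have := rotated_expsum_le n.+1 k (fun l => a`_l) al t A (al j * th) tn0 hAt.
    by rewrite tb.
have cj : c j = a`_j by rewrite /c subrr cos0 mulr1.
rewrite cj in key.
have D0 : 0 < prod_dist alpha j.
  apply: prodr_gt0 => i ij; rewrite normr_gt0 subr_eq0 nth_uniq ?size_tuple//.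
    by rewrite eq_sym.
  exact: (sorted_uniq lt_trans ltxx).
rewrite /= ler_pdivlMr ?mulr_gt0 ?exprn_gt0// mulrCA mulrC.
apply: le_trans (ler_wpM2r _ key) _; first by rewrite exprn_ge0 ?ltW.
apply: elimination_constant_le => //; last exact: ltW.
(* The exponent N * (alpha_max - alpha_min + min |alpha| + 2) is at least 2 N. *)
have r0 : 0 <= alpha`_n - alpha`_0.
  by rewrite subr_ge0 lt_sorted_leq_nth ?inE ?size_tuple.
have m0 : 0 <= min_abs alpha by apply: le_bigmin.
by rewrite mulrC ler_pM2l ?ltr0n//; lra.
Qed.

Theorem lemma3p1 (R : realType) (N : nat) (C0 C1 : R) (alpha : N.-tuple R) :
  (0 < N)%N -> 0 < C0 -> 0 < C1 -> sorted <%R alpha ->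
  (exists Ct : R, 0 < Ct /\ coef_bound_holds C0 C1 alpha Ct) /\
  coef_bound_holds C0 C1 alpha (2 * C1 * C0 `^ (max_abs alpha + 1)).
Proof.
move=> N0 C00 C10 hal.
have H := coef_bound_explicit N C0 C1 alpha N0 C00 C10 hal.
split=> //; exists (2 * C1 * C0 `^ (max_abs alpha + 1)); split=> //.
by rewrite !mulr_gt0 ?powR_gt0.
Qed.
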